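(* Let $K$ be a number field with ring of integers $\mathcal{O}_K$, and let $r$ be the rank of the unit group $\mathcal{O}_K^*$. Let $L,M\ge 0$ be integers and let $\mathcal{W}\subseteq\{x^ly^m:0\le l\le L,\ 0\le m\le M\}$ be a nonempty set of monomials with elements $f_1,\dots,f_w$, where $w=|\mathcal{W}|$, and let $d_{\mathcal{W}}=\sum_{f\in\mathcal{W}}\deg(f)$. There exist a constant $b>0$ depending only on $K$ and a constant $B>0$ depending only on $K$ and $\mathcal{W}$ such that for every real $H\ge 2$ and every $S\subseteq\{(\alpha,\beta)\in\mathcal{O}_K\times\mathcal{O}_K: H(\alpha)\le H,\ H(\beta)\le H\}$ there exists a subset $S'\subseteq S$ with $$|S'|\ge b\,\frac{|S|}{(\log H)^{2r}}$$ such that for every $P_1,P_2,\dots,P_w\in S'$, $$H\bigl(\det\bigl((f_i(P_j))_{1\le i,j\le w}\bigr)\bigr)\le B\,H^{d_{\mathcal{W}}},$$ where $H(\cdot)$ is the multiplicative height on $K$.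
   Context: For a number field $K$, let $M_K$ be its set of places. For an Archimedean place $v$ associated with an embedding $\sigma:K\to\mathbb{C}$, $|\alpha|_v=|\sigma(\alpha)|$ (usual absolute value). For a non-Archimedean place $v$ associated with a prime ideal $\mathfrak{p}$ above the rational prime $p$, $|\alpha|_v=p^{-v_{\mathfrak{p}}(\alpha)/e_{\mathfrak{p}}}$, where $v_{\mathfrak{p}}(\alpha)$ is the exponent of $\mathfrak{p}$ in the factorization of $\alpha\mathcal{O}_K$ and $e_{\mathfrak{p}}$ is the ramification index (and $|0|_v=0$). Put $n_v=[K_v:\mathbb{Q}_v]$. The multiplicative height of $\alpha\in K$ (relative to $K$, not normalized by the degree) is $H(\alpha)=\prod_{v\in M_K}\max(1,|\alpha|_v^{n_v})$. The degree of the monomial $x^ly^m$ is $l+m$, and $f(P)$ denotes the value of the monomial $f$ at the point $P=(\alpha,\beta)$. If $r=0$, $(\log H)^{2r}$ is $1$. *)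

(* Defs.v *)
From HB Require Import structures.
From mathcomp Require Import all_boot all_order all_algebra all_field.
From mathcomp Require Import complex.
From mathcomp Require Import all_classical all_reals all_analysis.
Set Implicit Arguments.
Unset Strict Implicit.
Unset Printing Implicit Defensive.
Import Order.TTheory GRing.Theory Num.Theory.

Local Open Scope classical_set_scope.
Local Open Scope ring_scope.

(* A number field is a [K : fieldExtType rat]: a field of finite degree over
   the rationals. The ring of integers, its ideals and its units are subsets
   of K. *)
Definition ring_of_integers (K : fieldExtType rat) : set K :=
  [set x | integralOver (intr : int -> K) x].

Definition is_unit (K : fieldExtType rat) (u : K) : Prop :=
  [/\ u != 0, ring_of_integers u & ring_of_integers u^-1].

Definition mult_independent (K : fieldExtType rat) (n : nat)
    (u : 'I_n -> K) : Prop :=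
  forall k : 'I_n -> int, \prod_(i < n) u i ^ k i = 1 -> forall i, k i = 0.

Definition largest (P : nat -> Prop) (n : nat) : Prop :=
  P n /\ forall m, P m -> (m <= n)%N.

Definition is_unit_rank (K : fieldExtType rat) (r : nat) : Prop :=
  largest (fun n => exists u : 'I_n -> K,
    (forall i, is_unit (u i)) /\ mult_independent u) r.

Definition is_prime_ideal (K : fieldExtType rat) (P : set K) : Prop :=
  [/\ P `<=` @ring_of_integers K,
      P 0 /\ (forall x y, P x -> P y -> P (x + y)),
      forall a x, ring_of_integers a -> P x -> P (a * x),
      ~ P 1 &
      forall x y, ring_of_integers x -> ring_of_integers y ->
        P (x * y) -> P x \/ P y].

Definition nonzero_prime (K : fieldExtType rat) (P : set K) : Prop :=
  is_prime_ideal P /\ P != [set 0].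

Definition ideal_mul (K : fieldExtType rat) (I J : set K) : set K :=
  [set x | exists n (a b : 'I_n -> K),
     (forall i, I (a i) /\ J (b i)) /\ x = \sum_(i < n) a i * b i].

Definition ideal_prod (K : fieldExtType rat) (s : seq (set K)) : set K :=
  foldr (@ideal_mul K) (@ring_of_integers K) s.

Definition principal (K : fieldExtType rat) (a : K) : set K :=
  [set a * x | x in @ring_of_integers K].

(* n is the exponent of P in the factorization of the fractional ideal
   a O_K, written as a O_K * (product of t) = (product of s) where s and t
   list, with multiplicity, the primes of positive and of negative exponent. *)
Definition is_exponent (K : fieldExtType rat) (P : set K) (a : K) (n : int) :
    Prop :=
  exists s t : seq (set K),
    [/\ forall Q, Q \in s ++ t -> nonzero_prime Q,
        forall Q, Q \in s -> Q \notin t,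
        ideal_mul (principal a) (ideal_prod t) = ideal_prod s &
        n = (count_mem P s)%:Z - (count_mem P t)%:Z].

Definition exponent (K : fieldExtType rat) (P : set K) (a : K) : int :=
  xget 0 (is_exponent P a).

Definition residue_char (K : fieldExtType rat) (P : set K) : nat :=
  xget 0%N [set p | prime p /\ P p%:R].

Definition ramification (K : fieldExtType rat) (P : set K) : int :=
  exponent P (residue_char P)%:R.

Definition finite_abs (R : realType) (K : fieldExtType rat) (P : set K)
    (a : K) : R :=
  if a == 0 then 0
  else (residue_char P)%:R `^ (- (exponent P a)%:~R / (ramification P)%:~R).

Definition infinite_abs (R : realType) (K : fieldExtType rat)
    (sigma : {rmorphism K -> R[i]}) (a : K) : R :=
  ComplexField.Normc.normc (sigma a).

(* A place is represented by its normalized absolute value; the two complex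
   conjugate embeddings of a complex place give the same function. *)
Definition places (R : realType) (K : fieldExtType rat) : set (K -> R) :=
  range (@infinite_abs R K) `|`
  (@finite_abs R K @` (@nonzero_prime K)).

Definition v_cauchy (R : realType) (K : fieldExtType rat) (v : K -> R)
    (x : nat -> K) : Prop :=
  forall e : R, 0 < e -> exists N : nat, forall m n : nat,
    (N <= m)%N -> (N <= n)%N -> v (x m - x n) < e.

Definition v_null (R : realType) (K : fieldExtType rat) (v : K -> R)
    (x : nat -> K) : Prop :=
  forall e : R, 0 < e -> exists N : nat, forall n : nat,
    (N <= n)%N -> v (x n) < e.

(* The completion K_v is the set of v-Cauchy sequences of K modulo v-null
   sequences, and Q_v consists of the classes of the v-Cauchy sequences of
   rationals. This is linear independence over Q_v of the classes of the
   sequences x i in K_v. *)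
Definition Qv_independent (R : realType) (K : fieldExtType rat) (v : K -> R)
    (n : nat) (x : 'I_n -> nat -> K) : Prop :=
  forall c : 'I_n -> nat -> rat,
    (forall i, v_cauchy v (fun k => (c i k)%:A)) ->
    v_null v (fun k => \sum_(i < n) c i k *: x i k) ->
    forall i, v_null v (fun k => (c i k)%:A).

Definition local_degree (R : realType) (K : fieldExtType rat) (v : K -> R) :
    nat :=
  xget 0%N (largest (fun n => exists x : 'I_n -> nat -> K,
    (forall i, v_cauchy v (x i)) /\ Qv_independent v x)).

Definition height (R : realType) (K : fieldExtType rat) (a : K) : R :=
  \big[*%R/1]_(v \in @places R K) Num.max 1 (v a ^+ local_degree v).

(* The pair (l, m) stands for the monomial x^l y^m. *)
Definition monomial_deg (L M : nat) (f : 'I_L.+1 * 'I_M.+1) : nat :=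
  (f.1 + f.2)%N.

Definition monomial_eval (K : fieldExtType rat) (L M : nat)
    (f : 'I_L.+1 * 'I_M.+1) (P : K * K) : K :=
  P.1 ^+ f.1 * P.2 ^+ f.2.

Definition integral_points (R : realType) (K : fieldExtType rat) (H : R) :
    set (K * K) :=
  [set P | [/\ ring_of_integers P.1, ring_of_integers P.2,
               height R P.1 <= H & height R P.2 <= H]].

Arguments integral_points {R} K H _.

(* Main.v *)
Require Import Defs.
From HB Require Import structures.
From mathcomp Require Import all_boot all_order all_algebra all_field.
From mathcomp Require Import perm finmap complex.
From mathcomp Require Import all_classical all_reals all_analysis.
From mathcomp Require Import ring lra zify.
Set Implicit Arguments.
Unset Strict Implicit.
Unset Printing Implicit Defensive.
Import Order.TTheory GRing.Theory Num.Theory.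

(* For an integral point only the Archimedean places contribute to the height,
   so the vector of the local heights max(1, |a|_v^{n_v}) has coordinates >= 1
   with product at most H. Rounding the logarithms of all its coordinates but
   one places it in one of O((log H)^p) boxes, p + 1 being the number of
   Archimedean places, each box being cut out by upper bounds X_v of product
   O(H). The most popular pair of boxes gives S', and expanding the determinant
   bounds its local heights by a constant times the product of the
   X_v^l Y_v^m.

   It remains to see that p <= r, i.e. that there are p independent units. For
   every Archimedean place v, pigeonhole on integer combinations of a lattice
   basis gives lattice elements of bounded norm that are arbitrarily small at
   all the other places; two of them with the same norm N that are congruent
   modulo N have as quotient a unit of absolute value < 1 away from v. The
   logarithms of these units form a matrix whose nonsingularity follows from
   diagonal dominance.

   The values of the local degrees n_v play no role: dependence between units
   is measured by summing over the embeddings, grouped by absolute value. *)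

Local Open Scope classical_set_scope.
Local Open Scope ring_scope.

(** * Nonarchimedean places *)

Section IntegralIdeals.
Variable K : fieldExtType rat.
Local Notation O := (@ring_of_integers K).

Lemma ring_of_integersD (x y : K) : O x -> O y -> O (x + y).
Proof. exact: integral_add. Qed.

Lemma ring_of_integersM (x y : K) : O x -> O y -> O (x * y).
Proof. exact: integral_mul. Qed.

Lemma ring_of_integers_int (m : int) : O m%:~R.
Proof. exact: (@integral_id int K intr m). Qed.

Lemma ring_of_integers1 : O 1.
Proof. exact: (ring_of_integers_int 1). Qed.

Lemma ring_of_integers_sum (I : Type) (s : seq I) (P : pred I) (F : I -> K) :
  (forall i, P i -> O (F i)) -> O (\sum_(i <- s | P i) F i).
Proof.
move=> OF; elim/big_ind: _ => //; first exact: (ring_of_integers_int 0).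
exact: ring_of_integersD.
Qed.

Lemma ring_of_integers_prod (I : Type) (s : seq I) (P : pred I) (F : I -> K) :
  (forall i, P i -> O (F i)) -> O (\prod_(i <- s | P i) F i).
Proof.
move=> OF; elim/big_ind: _ => //; first exact: ring_of_integers1.
exact: ring_of_integersM.
Qed.

Lemma ring_of_integersX (x : K) n : O x -> O (x ^+ n).
Proof.
move=> Ox; elim: n => [|n IHn]; first exact: ring_of_integers1.
by rewrite exprS; exact: ring_of_integersM.
Qed.

Lemma ring_of_integers_det n (A : 'M[K]_n) :
  (forall i j, O (A i j)) -> O (\det A).
Proof.
move=> OA; apply: ring_of_integers_sum => s _; apply: ring_of_integersM.
  rewrite -signr_odd; apply: ring_of_integersX.
  exact: (ring_of_integers_int (-1)).
exact: ring_of_integers_prod.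
Qed.

Lemma ring_of_integers_horner (p : {poly int}) (x : K) :
  O x -> O (map_poly intr p).[x].
Proof.
move=> Ox; elim/poly_ind: p => [|p c IHp].
  by rewrite rmorph0 horner0; exact: (ring_of_integers_int 0).
rewrite rmorphD rmorphM /= map_polyX map_polyC hornerMXaddC.
exact: ring_of_integersD (ring_of_integersM IHp Ox) (ring_of_integers_int _).
Qed.

Lemma zero_prime_ideal : is_prime_ideal [set (0 : K)].
Proof.
split => //=.
- by move=> _ ->; exact: (ring_of_integers_int 0).
- by split=> // _ _ -> ->; rewrite addr0.
- by move=> a _ _ ->; rewrite mulr0.
- exact/eqP/oner_neq0.
- move=> x y _ _ /eqP; rewrite mulf_eq0.
  by case/orP=> /eqP; [left | right].
Qed.

(* [c] is the lowest coefficient outside [P] of a monic polynomial killing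
   [x]; the powers of [x] below it are divided out since [x] is not in [P]. *)
Lemma integral_mod_prime (P : set K) (x : K) : is_prime_ideal P -> O x ->
  ~ P x -> exists (c : int) (y : K), [/\ ~ P c%:~R, O y & P (x * y + c%:~R)].
Proof.
move=> [PO [P0 PD] PM P1 PP] Ox nPx; case: (Ox) => p mon_p /rootP px0.
have: P (map_poly intr p).[x] by rewrite px0.
elim/poly_ind: p mon_p {px0} => [|p c IHp] mon_p.
  by move: mon_p; rewrite monicE lead_coef0 eq_sym oner_eq0.
rewrite rmorphD rmorphM /= map_polyX map_polyC hornerMXaddC => Pf.
have [Pc|nPc] := pselect (P c%:~R); last first.
  exists c, (map_poly intr p).[x]; split=> //.
    exact: ring_of_integers_horner.
  by rewrite mulrC.
have Ppx : P ((map_poly intr p).[x] * x).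
  have := PD _ _ Pf (PM (-1) _ (ring_of_integers_int (-1)) Pc).
  by rewrite mulN1r addrK.
have [//|Pp] := PP _ _ (ring_of_integers_horner p Ox) Ox Ppx; last by [].
have [p0|p_neq0] := eqVneq p 0.
  move: mon_p; rewrite p0 mul0r add0r monicE lead_coefC => /eqP c1.
  by case: P1; rewrite c1 in Pc.
apply: IHp => //; move: mon_p.
by rewrite !monicE lead_coefDl ?lead_coefMX // size_mulX // ltnS size_polyC
   (leq_trans (leq_b1 _)) // size_poly_gt0.
Qed.

(** A nonzero [x] in [P] lies outside the zero prime ideal, so [integral_mod_prime] gives
    [x * y + c = 0] with a nonzero integer [c]. Then [c] is in [P], and primality descends to one of
    its prime factors. *)
Lemma prime_ideal_prime (P : set K) : nonzero_prime P ->
  exists2 p, prime p & P p%:R.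
Proof.
case=> PP /eqP Pn0; have [PO [P0 PD] PM P1 Pxy] := PP.
have [x [Px /eqP x_neq0]] : exists x, P x /\ x <> 0.
  apply: contrapT => nx; apply: Pn0; apply/seteqP; split=> [x Px|_ ->//].
  by apply: contrapT => x0; apply: nx; exists x.
have [c [y [/= c0 Oy]]] := integral_mod_prime zero_prime_ideal (PO _ Px)
  (fun h => negP x_neq0 (introT eqP h)).
move=> xyc; have Pc : P c%:~R.
  have -> : c%:~R = (-y) * x.
    by apply/eqP; rewrite mulNr -addr_eq0 addrC mulrC xyc.
  by apply: PM => //; exact: integral_opp.
have {Pc} Pabs : P (`|c|%N)%:R.
  rewrite -[_%:R]/(`|c|%N%:Z%:~R) abszE.
  have [c0'|c0'] := leP 0 c; first by rewrite ger0_norm.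
  rewrite ltr0_norm // mulrNz -mulN1r; apply: PM => //.
  exact: (ring_of_integers_int (-1)).
have : (0 < `|c|)%N by rewrite absz_gt0; apply/eqP => c0'; apply: c0; rewrite c0'.
elim/ltn_ind: `|c|%N Pabs => m IHm Pm m_gt0.
have [m_le1|m_gt1] := leqP m 1.
  by have m1: m = 1%N; [apply/eqP; rewrite eqn_leq m_le1|case: P1; rewrite m1 in Pm].
have := Pm; rewrite -{1}(divnK (pdiv_dvd m)) natrM => /Pxy[||Pd|Pd].
- exact: (ring_of_integers_int (Posz _)).
- exact: (ring_of_integers_int (Posz _)).
- apply: (IHm _ _ Pd); first by rewrite ltn_Pdiv // prime_gt1 // pdiv_prime.
  by rewrite divn_gt0 ?pdiv_gt0 // dvdn_leq ?pdiv_dvd.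
- by exists (pdiv m); [exact: pdiv_prime|].
Qed.

(** For [x] in [P] outside [Q], [integral_mod_prime] yields an integer [c] in [P] but not in [Q]. It
    is coprime to the prime [p] in [Q], and a Bezout relation would put 1 in [P]. *)
Lemma prime_ideal_maximal (P Q : set K) : nonzero_prime Q ->
  is_prime_ideal P -> Q `<=` P -> Q = P.
Proof.
move=> nQ PP QP; have [p p_pr Qp] := prime_ideal_prime nQ.
have [QP' _] := nQ; have [QO [Q0 QD] QM Q1 Qxy] := QP'.
have [PO [P0 PD] PM P1 Pxy] := PP.
apply/seteqP; split=> // x Px; apply: contrapT => nQx.
have [c [y [nQc Oy Qxyc]]] := integral_mod_prime QP' (PO _ Px) nQx.
have Pc : P c%:~R.
  have := PD _ _ (QP _ Qxyc) (PM (- y) _ (integral_opp Oy) Px).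
  by rewrite mulNr [y * x]mulrC addrAC subrr add0r.
have [/dvdzP[q cq]|ncp] := boolP (p %| c)%Z.
  apply: nQc; rewrite cq intrM; apply: QM => //; exact: ring_of_integers_int.
have : coprimez p c.
  by rewrite /coprimez /gcdz /= -[_ == _]/(coprime _ _) prime_coprime.
case/coprimezP=> [[u v] /= uv1]; apply: P1.
have -> : (1 : K) = (u * p + v * c)%:~R by rewrite uv1.
rewrite intrD !intrM; apply: PD; apply: PM => //; try exact: ring_of_integers_int.
exact: QP.
Qed.

Lemma ideal_mul_sub (I J P : set K) : P 0 ->
  (forall x y, P x -> P y -> P (x + y)) ->
  (forall x y, I x -> J y -> P (x * y)) -> ideal_mul I J `<=` P.
Proof.
move=> P0 PD IJ x [n [a [b [ab ->]]]].
by elim/big_ind: _ => // i _; apply: IJ; case: (ab i).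
Qed.

Lemma ideal_mulP (I J : set K) (x y : K) : I x -> J y -> ideal_mul I J (x * y).
Proof.
move=> Ix Jy; exists 1%N, (fun=> x), (fun=> y); split=> //.
by rewrite big_ord1.
Qed.

Lemma ideal_prod_integral (s : seq (set K)) :
  (forall Q, Q \in s -> nonzero_prime Q) -> ideal_prod s `<=` O.
Proof.
elim: s => [|Q s IHs] sP //=; apply: ideal_mul_sub.
- exact: (ring_of_integers_int 0).
- exact: ring_of_integersD.
move=> x y Qx sy; apply: ring_of_integersM.
  by have [[QO _ _ _ _] _] := sP Q (mem_head _ _); exact: QO.
by apply: IHs sy => P Ps; apply: sP; rewrite inE Ps orbT.
Qed.

Lemma ideal_prod_sub (P : set K) (s : seq (set K)) :
  (forall Q, Q \in s -> nonzero_prime Q) -> P \in s -> ideal_prod s `<=` P.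
Proof.
elim: s => [|Q s IHs] // sP; rewrite inE => Ps /=.
have sP' Q' : Q' \in s -> nonzero_prime Q'.
  by move=> Q's; apply: sP; rewrite inE Q's orbT.
have [[PO [P0 PD] PM _ _] _] : nonzero_prime P by exact: sP.
apply: ideal_mul_sub => // x y Qx sy; case/orP: Ps => [/eqP PQ|Ps].
  rewrite mulrC; apply: PM; first exact: ideal_prod_integral sy.
  by rewrite PQ.
apply: PM; last exact: IHs sy.
by have [[QO _ _ _ _] _] := sP Q (mem_head _ _); exact: QO.
Qed.

Lemma ideal_prod_prime (P : set K) (s : seq (set K)) : is_prime_ideal P ->
  (forall Q, Q \in s -> nonzero_prime Q) -> ideal_prod s `<=` P ->
  exists2 Q, Q \in s & Q `<=` P.
Proof.
move=> PP; have [PO [P0 PD] PM P1 Pxy] := PP.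
elim: s => [|Q s IHs] sP /= sub.
  by case: P1; apply: sub; exact: ring_of_integers1.
have sP' Q' : Q' \in s -> nonzero_prime Q'.
  by move=> Q's; apply: sP; rewrite inE Q's orbT.
have [QP|nQP] := pselect (Q `<=` P); first by exists Q; rewrite ?mem_head.
have [q Qq nPq] : exists2 q, Q q & ~ P q.
  apply: contrapT => nq; apply: nQP => q Qq.
  by apply: contrapT => nPq; apply: nq; exists q.
have [[QO _ _ _ _] _] := sP Q (mem_head _ _).
have [|Q' Q's Q'P] := IHs sP'; last by exists Q'; rewrite // inE Q's orbT.
move=> y sy; have Pqy : P (q * y) by apply: sub; exact: ideal_mulP.
by have [] := Pxy q y (QO _ Qq) (ideal_prod_integral sP' sy) Pqy.
Qed.

(** If [P] occurred in [t], it would contain the product of [s], hence some prime of [s], which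
    equals [P] by maximality; but [s] and [t] are disjoint. Without a factorization, [xget] returns
    0. *)
Lemma exponent_ge0 (P : set K) (a : K) : nonzero_prime P -> O a ->
  0 <= exponent P a.
Proof.
move=> nP Oa; rewrite /exponent; case: xgetP => // n _ [s [t [stP dis eq ->]]].
have sP Q : Q \in s -> nonzero_prime Q.
  by move=> Qs; apply: stP; rewrite mem_cat Qs.
have tP Q : Q \in t -> nonzero_prime Q.
  by move=> Qt; apply: stP; rewrite mem_cat Qt orbT.
have [Pt|nPt] := boolP (P \in t); last first.
  by rewrite (count_memPn nPt) subr0.
have [PP _] := nP; have [PO [P0 PD] PM P1 Pxy] := PP.
have [|Q Qs QP] := ideal_prod_prime PP sP.
  rewrite -eq; apply: ideal_mul_sub => // _ y [z Oz <-] ty.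
  apply: PM; first exact: ring_of_integersM.
  exact: ideal_prod_sub ty.
have QPE := prime_ideal_maximal (sP _ Qs) PP QP.
by move: (dis _ Qs); rewrite QPE Pt.
Qed.

Lemma finite_abs_le1 (R : realType) (P : set K) (a : K) : nonzero_prime P ->
  O a -> finite_abs R P a <= 1.
Proof.
move=> nP Oa; rewrite /finite_abs; case: ifP => // _.
have e_ge0 := exponent_ge0 nP Oa.
have r_ge0 : 0 <= ramification P.
  exact/exponent_ge0/(ring_of_integers_int (Posz _)).
set e := - _ / _; have e_le0 : e <= 0.
  by rewrite /e mulNr oppr_le0 divr_ge0 // ler0z.
(* The value 0 is the default of [residue_char]; the power of 0 is then 1 or 0. *)
case: (residue_char P) => [|p].
  by have [->|e_neq0] := eqVneq e 0; rewrite ?powRr0 // powR0.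
by rewrite -[leRHS](powRr0 p.+1%:R) ler_powR // ler1n.
Qed.

End IntegralIdeals.

(** * Embeddings and an integral lattice *)

Section Embeddings.
Variable K : fieldExtType rat.

(** The primitive element theorem, presenting [K] as the rational polynomials modulo the minimal
    polynomial [f] of [t]; separability comes from characteristic 0. *)
Lemma primitive_polynomial : exists (t : K) (f : {poly rat}),
  [/\ f \is monic, (1 < size f)%N, separable_poly f,
      forall p, ((map_poly (in_alg K) p).[t] = 0) <-> (f %| p)%R &
      forall x, exists q, x = (map_poly (in_alg K) q).[t]].
Proof.
have sepK : separable 1 {:K}.
  apply/separableP => y _; apply: pcharf0_separable => p.
  by rewrite (pchar_lalg K) pchar_num.
have := eq_adjoin_separable_generator sepK (sub1v _).
set t := separable_generator _ _ => Kt.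
have /polyOver1P[f Df] := minPolyOver 1%AS t.
exists t, f; split.
- by rewrite -(map_monic (in_alg K)) -Df monic_minPoly.
- by rewrite -(size_map_poly (in_alg K)) -Df size_minPoly.
- rewrite -(separable_map (in_alg K)) -Df.
  exact: separable_generatorP.
- move=> p; rewrite -(dvdp_map (in_alg K)) -Df; split=> [pt|/dvdpP[q ->]].
    by apply: minPoly_dvdp; [apply/polyOver1P; exists p|apply/rootP].
  by rewrite hornerM minPolyxx mulr0.
move=> x; have : x \in <<1; t>>%VS by rewrite -Kt memvf.
case/Fadjoin_polyP=> p /polyOver1P[q ->] ->; by exists q.
Qed.

Lemma horner_map_dvd (C : numFieldType) (f p : {poly rat}) (z : C) :
  (f %| p)%R -> root (map_poly ratr f) z -> (map_poly ratr p).[z] = 0.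
Proof.
by move=> /dvdpP[q ->] /rootP fz; rewrite rmorphM hornerM fz mulr0.
Qed.

Lemma rmorph_horner_rat (C : numFieldType) (s : {rmorphism K -> C}) p (x : K) :
  s (map_poly (in_alg K) p).[x] = (map_poly ratr p).[s x].
Proof.
rewrite -horner_map -map_poly_comp; congr (_.[_]); apply: eq_map_poly => a /=.
by rewrite alg_num_field fmorph_rat.
Qed.

(** Evaluation at [z] kills the multiples of [f], so it factors through [K]; [sE] is the
    independence of the chosen representative [q x]. *)
Lemma root_embedding (C : numFieldType) (t : K) (f : {poly rat}) (z : C) :
  (forall p, ((map_poly (in_alg K) p).[t] = 0) <-> (f %| p)%R) ->
  (forall x, exists q, x = (map_poly (in_alg K) q).[t]) ->
  root (map_poly ratr f) z -> exists s : {rmorphism K -> C}, s t = z.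
Proof.
move=> ft /choice[q qE] fz.
pose s x : C := (map_poly ratr (q x)).[z].
have sE p x : (map_poly (in_alg K) p).[t] = x -> s x = (map_poly ratr p).[z].
  move=> px; apply/eqP; rewrite -subr_eq0 /s -hornerN -hornerD -!rmorphN -rmorphD.
  apply/eqP/horner_map_dvd; last exact: fz.
  by apply/ft; rewrite rmorphB hornerD hornerN -qE px subrr.
have sB : zmod_morphism s.
  move=> x y; rewrite (sE (q x - q y)); first by rewrite rmorphB hornerD hornerN.
  by rewrite rmorphB hornerD hornerN -!qE.
have sM : monoid_morphism s.
  split; first by rewrite (sE 1) rmorph1 hornerC.
  move=> x y; rewrite (sE (q x * q y)); first by rewrite rmorphM hornerM.
  by rewrite rmorphM hornerM -!qE.
pose sA := GRing.isZmodMorphism.Build _ _ _ sB.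
pose sR := GRing.isMonoidMorphism.Build _ _ _ sM.
pose S : {rmorphism K -> C} := HB.pack s sA sR.
exists S; rewrite /= (sE 'X) ?map_polyX ?hornerX //.
Qed.

Lemma common_denominator (I : finType) (F : I -> rat) :
  exists2 D : int, D != 0 & forall i, exists c : int, D%:~R * F i = c%:~R.
Proof.
exists (\prod_i denq (F i)); first by apply/prodf_neq0 => i _; exact: denq_neq0.
move=> i; exists (numq (F i) * \prod_(j | j != i) denq (F j)).
rewrite (bigD1 i) //= !rmorphM /= mulrAC; congr (_ * _).
by rewrite numqE mulrC.
Qed.

(** The lattice is spanned by the multiples [D * t ^+ i] of the powers of a primitive element, and
    its matrix of embeddings is [D] times a Vandermonde matrix at the distinct roots of [f]. *)
Lemma field_lattice (C : numClosedFieldType) : exists n (w : 'I_n -> K)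
    (s : 'I_n -> {rmorphism K -> C}),
  [/\ (0 < n)%N, forall t : {rmorphism K -> C}, exists j, t =1 s j,
      \det (\matrix_(i, j) s j (w i)) != 0 &
      forall i j, exists c : 'I_n -> int, w i * w j = \sum_k (c k)%:~R * w k].
Proof.
have [t [f [f_mon f_gt1 f_sep ft tK]]] := primitive_polynomial.
have [rs Drs] := closed_field_poly_normal (map_poly (ratr : rat -> C) f).
have fC_mon : map_poly (ratr : rat -> C) f \is monic by rewrite map_monic.
rewrite (monicP fC_mon) scale1r in Drs.
have uniq_rs : uniq rs.
  rewrite -separable_prod_XsubC -Drs.
  by rewrite (separable_map (ratr : {rmorphism rat -> C})).
have size_rs : (size rs).+1 = size f.
  by rewrite -(size_map_poly (ratr : {rmorphism rat -> C})) Drs size_prod_XsubC.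
have root_rs (z : C) : root (map_poly ratr f) z = (z \in rs).
  by rewrite Drs root_prod_XsubC.
have : forall j : 'I_(size rs), exists s : {rmorphism K -> C}, s t = rs`_j.
  by move=> j; apply: root_embedding ft tK _; rewrite root_rs mem_nth.
move=> /choice[s sE]; exists (size rs).
(* [D] clears the denominators of the powers [t ^+ (i + j)] reduced modulo [f]. Of the two factors
   [D] in [w i * w j], one does this and the other rebuilds the [w k]. *)
have [D D_neq0 Dint] := common_denominator
  (fun ijk : 'I_(size rs) * 'I_(size rs) * 'I_(size rs) =>
     ('X^(ijk.1.1 + ijk.1.2) %% f)`_ijk.2).
exists (fun i => D%:~R * t ^+ i), s; split.
- by rewrite -ltnS size_rs.
- move=> u; have : u t \in rs.
    rewrite -root_rs; apply/rootP; rewrite -rmorph_horner_rat.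
    by have /ft -> := dvdpp f; rewrite rmorph0.
  move=> utr; exists (Ordinal (etrans (index_mem _ _) utr)) => x.
  have [q ->] := tK x.
  by rewrite !rmorph_horner_rat sE /= nth_index.
- pose a : 'rV[C]_(size rs) := \row_j rs`_j.
  have -> : \matrix_(i, j) s j (D%:~R * t ^+ i)
      = (D%:~R : C) *: Vandermonde (size rs) a.
    apply/matrixP => i j; rewrite !mxE rmorphM rmorphXn /= sE.
    by rewrite rmorph_int.
  rewrite detZ mulf_neq0 //; first by rewrite expf_neq0 // intr_eq0.
  rewrite det_Vandermonde; apply/prodf_neq0 => i _; apply/prodf_neq0 => j ij.
  by rewrite !mxE subr_eq0 nth_uniq ?ltn_ord // gt_eqF.
move=> i j; have := fun k => Dint (i, j, k) => /choice[c cE]; exists c.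
have -> : D%:~R * t ^+ i * (D%:~R * t ^+ j)
    = D%:~R * (D%:~R * t ^+ (i + j)) by rewrite exprD; ring.
have -> : t ^+ (i + j) =
    (map_poly (in_alg K) ('X^(i + j) %% f)).[t].
  apply/eqP; rewrite -subr_eq0 -[t ^+ _]hornerXn.
  rewrite -(map_polyXn (in_alg K)) -hornerN -hornerD -rmorphN -rmorphD.
  apply/eqP/ft; rewrite {1}(divp_eq 'X^(i + j) f) addrK dvdp_mull //.
rewrite (@horner_coef_wide _ (size rs)); last first.
  rewrite size_map_poly -ltnS size_rs ltn_modp.
  by rewrite -size_poly_eq0 -lt0n (ltn_trans _ f_gt1).
rewrite !mulr_sumr; apply: eq_bigr => k _; rewrite coef_map /=.
have -> : (c k)%:~R = in_alg K (c k)%:~R by rewrite rmorph_int.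
rewrite -cE [in_alg K _]rmorphM /= -![_%:A]/(in_alg K _) [in_alg K D%:~R]rmorph_int.
ring.
Qed.

End Embeddings.

(** * Multiplication matrices and norms on the lattice *)

Section Lattice.
Variables (K : fieldExtType rat) (C : numFieldType) (n : nat).
Variables (w : 'I_n -> K) (s : 'I_n -> {rmorphism K -> C}).
Hypothesis n_gt0 : (0 < n)%N.
Hypothesis s_w : \det (\matrix_(i, j) s j (w i)) != 0.
Hypothesis w_mul : forall i j, exists c : 'I_n -> int,
  w i * w j = \sum_k (c k)%:~R * w k.

Definition int_comb (c : 'I_n -> int) : K := \sum_k (c k)%:~R * w k.

Lemma rmorph_int_comb c j : s j (int_comb c) = \sum_k (c k)%:~R * s j (w k).
Proof.
by rewrite rmorph_sum; apply: eq_bigr => k _; rewrite rmorphM rmorph_int.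
Qed.

Lemma int_comb_eq0 c : int_comb c = 0 -> forall k, c k = 0.
Proof.
move=> c0 k; pose S := \matrix_(i, j) s j (w i).
have S_unit : S \in unitmx by rewrite unitmxE unitfE.
pose v : 'rV[C]_n := \row_i (c i)%:~R.
have vS : v *m S = 0.
  apply/rowP => j; rewrite !mxE -[RHS](rmorph0 (s j)) -c0 rmorph_int_comb.
  by apply: eq_bigr => i _; rewrite !mxE.
have : v = 0 by rewrite -[v](mulmxK S_unit) vS mul0mx.
by move/rowP/(_ k); rewrite !mxE => /eqP; rewrite intr_eq0 => /eqP.
Qed.

Lemma int_comb_mul c : exists M : 'M[int]_n,
  forall i, int_comb c * w i = \sum_k (M i k)%:~R * w k.
Proof.
have /choice[d dE] : forall ij : 'I_n * 'I_n, exists c : 'I_n -> int,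
  w ij.1 * w ij.2 = \sum_k (c k)%:~R * w k by case=> i j; exact: w_mul.
exists (\matrix_(i, k) \sum_j c j * d (j, i) k) => i.
rewrite mulr_suml.
under eq_bigr do rewrite -mulrA (dE (_, _)) mulr_sumr.
rewrite exchange_big; apply: eq_bigr => k _ /=.
rewrite mxE rmorph_sum mulr_suml; apply: eq_bigr => j _.
by rewrite rmorphM mulrA.
Qed.

(** The matrix of embeddings diagonalizes the multiplication matrix [M], with the [s j x] as
    eigenvalues. *)
Lemma prod_embeddings (M : 'M[int]_n) x :
  (forall i, x * w i = \sum_k (M i k)%:~R * w k) ->
  \prod_j s j x = (\det M)%:~R.
Proof.
move=> xM; pose S := \matrix_(i, j) s j (w i).
have MS : map_mx intr M *m S = S *m diag_mx (\row_j s j x).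
  apply/matrixP => i j; rewrite mul_mx_diag !mxE [RHS]mulrC -rmorphM xM rmorph_sum.
  by apply: eq_bigr => k _; rewrite !mxE rmorphM rmorph_int.
apply: (mulfI s_w); rewrite mulrC [RHS]mulrC -det_map_mx -det_mulmx MS.
rewrite det_mulmx det_diag mulrC; congr (_ * _).
by apply: eq_bigr => j _; rewrite mxE.
Qed.

(** The vector [w] is a nonzero eigenvector for [x], which is thus a root of a monic characteristic
    polynomial with integer coefficients. *)
Lemma integral_of_mul (M : 'M[int]_n) x :
  (forall i, x * w i = \sum_k (M i k)%:~R * w k) -> ring_of_integers x.
Proof.
move=> xM; exists (char_poly M^T); first exact: char_poly_monic.
rewrite (map_char_poly (intr : {rmorphism int -> K})) -eigenvalue_root_char.
apply/eigenvalueP; exists (\row_i w i).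
  apply/rowP => i; rewrite !mxE xM; apply: eq_bigr => k _.
  by rewrite !mxE mulrC.
apply/eqP => /rowP w0; case/negP: s_w; rewrite (expand_det_row _ (Ordinal n_gt0)).
apply/eqP/big1 => j _; have := w0 (Ordinal n_gt0); rewrite !mxE => ->.
by rewrite rmorph0 mul0r.
Qed.

(** The adjugate of [M] is an integer matrix representing multiplication by [\det M / x]. *)
Lemma integral_norm_div (M : 'M[int]_n) x : x != 0 ->
  (forall i, x * w i = \sum_k (M i k)%:~R * w k) ->
  ring_of_integers ((\det M)%:~R / x).
Proof.
move=> x_neq0 xM; apply: (@integral_of_mul (\adj M)) => i.
apply: (mulfI x_neq0); rewrite mulrA mulrCA divff // mulr1.
rewrite mulr_sumr; under eq_bigr do rewrite mulrCA xM mulr_sumr.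
rewrite exchange_big /=.
have -> : \sum_j \sum_k (\adj M i k)%:~R * ((M k j)%:~R * w j)
   = \sum_j ((\adj M *m M) i j)%:~R * w j.
  apply: eq_bigr => j _; rewrite mxE rmorph_sum mulr_suml.
  by apply: eq_bigr => k _; rewrite mulrA rmorphM.
rewrite mul_adj_mx (bigD1 i) //= big1 ?addr0 ?mxE ?eqxx ?mulr1n //.
by move=> j ji; rewrite mxE eq_sym (negPf ji) mulr0n mul0r.
Qed.

(* The quotient is [1 + (N / int_comb c') * int_comb d], and [N / int_comb c']
   is integral since [N] is the norm of [int_comb c']. *)
Lemma integral_div_congr (M : 'M[int]_n) (c c' d : 'I_n -> int) :
  int_comb c' != 0 ->
  (forall i, int_comb c' * w i = \sum_k (M i k)%:~R * w k) ->
  (forall k, c k = c' k + \det M * d k) ->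
  ring_of_integers (int_comb c / int_comb c').
Proof.
move=> c'_neq0 c'M cE.
have -> : int_comb c = int_comb c' + (\det M)%:~R * int_comb d.
  rewrite mulr_sumr -big_split; apply: eq_bigr => k _ /=.
  by rewrite cE rmorphD rmorphM /=; ring.
rewrite mulrDl divff // mulrAC; apply: ring_of_integersD.
  exact: ring_of_integers1.
apply: ring_of_integersM; first exact: integral_norm_div.
by have [M' dM'] := int_comb_mul d; exact: integral_of_mul dM'.
Qed.

End Lattice.

(** * Units *)

Section ComplexAbs.
Variable R : realType.
Local Notation nc := (@ComplexField.Normc.normc R).

Lemma normC_normc (z : R[i]) : `|z| = ((nc z)%:C)%C.
Proof. by case: z. Qed.

Lemma normc_ge0 (z : R[i]) : 0 <= nc z.
Proof. by case: z => a b; exact: sqrtr_ge0. Qed.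

Lemma normc_eq0 (z : R[i]) : (nc z == 0) = (z == 0).
Proof.
apply/eqP/eqP => [|->]; first exact: ComplexField.Normc.eq0_normc.
exact: ComplexField.Normc.normc0.
Qed.

Lemma normc_gt0 (z : R[i]) : (0 < nc z) = (z != 0).
Proof. by rewrite lt_neqAle normc_ge0 andbT eq_sym normc_eq0. Qed.

Lemma normc_int (m : int) : nc m%:~R = `|m|%:~R.
Proof. by apply: complexI; rewrite -normC_normc -intr_norm rmorph_int. Qed.

Lemma normcX (z : R[i]) k : nc (z ^+ k) = nc z ^+ k.
Proof.
elim: k => [|k IHk]; first exact: ComplexField.Normc.normc1.
by rewrite !exprS ComplexField.Normc.normcM IHk.
Qed.

Lemma normc_prod (I : Type) (t : seq I) (P : pred I) (F : I -> R[i]) :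
  nc (\prod_(i <- t | P i) F i) = \prod_(i <- t | P i) nc (F i).
Proof.
apply: (big_morph nc (@ComplexField.Normc.normcM R)).
exact: ComplexField.Normc.normc1.
Qed.

Lemma ler_normc_sum (I : Type) (t : seq I) (P : pred I) (F : I -> R[i]) :
  nc (\sum_(i <- t | P i) F i) <= \sum_(i <- t | P i) nc (F i).
Proof.
apply: (big_ind2 (fun z r => nc z <= r)) => //.
  by rewrite ComplexField.Normc.normc0.
move=> x1 x2 y1 y2 xy1 xy2.
by apply: le_trans (lerD xy1 xy2); exact: le_normcD.
Qed.

Lemma normc_le_ReIm (z : R[i]) : nc z <= `|complex.Re z| + `|complex.Im z|.
Proof.
case: z => a b /=; rewrite -[leRHS]ger0_norm ?addr_ge0 // -sqrtr_sqr ler_sqrt.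
  have := mulr_ge0 (normr_ge0 a) (normr_ge0 b).
  rewrite -[a ^+ 2]real_normK ?num_real // -[b ^+ 2]real_normK ?num_real //.
  nra.
exact: sqr_ge0.
Qed.

Lemma Re_le_normc (z : R[i]) : `|complex.Re z| <= nc z.
Proof.
case: z => a b /=.
by rewrite -sqrtr_sqr ler_sqrt ?addr_ge0 ?sqr_ge0 // lerDl sqr_ge0.
Qed.

Lemma Im_le_normc (z : R[i]) : `|complex.Im z| <= nc z.
Proof.
case: z => a b /=.
by rewrite -sqrtr_sqr ler_sqrt ?addr_ge0 ?sqr_ge0 // lerDr sqr_ge0.
Qed.

Lemma conjc_normc (z : R[i]) : nc (conjc z) = nc z.
Proof. by case: z => a b /=; rewrite sqrrN. Qed.

End ComplexAbs.

(** * Pigeonhole principles *)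

Section Pigeonhole.
Variable R : realType.

Lemma truncn_eq_dist (x y : R) : 0 <= x -> 0 <= y ->
  Num.truncn x = Num.truncn y -> `|x - y| < 1.
Proof.
move=> /truncn_itv + /truncn_itv + xy; rewrite -xy -natr1 ltr_norml.
by move=> /andP[x1 x2] /andP[y1 y2]; apply/andP; split; lra.
Qed.

(** Dirichlet's box principle: two vectors with entries in 0..[Q] have their values in the same cell
    of a subdivided cube, and their difference is [c]. *)
Lemma small_linear_forms (n Q k : nat) (J : finType) (G : 'I_n -> J -> R)
    (B : R) : 0 < B -> (0 < k)%N -> (forall i j, `|G i j| <= B) ->
  (k.+1 ^ #|J| < Q.+1 ^ n)%N ->
  exists c : 'I_n -> int, [/\ exists i, c i != 0, forall i, `|c i| <= Q%:Z &
    forall j, `|\sum_i (c i)%:~R * G i j| <= 2 * n%:R * B * Q%:R / k%:R].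
Proof.
move=> B_gt0 k_gt0 G_le lt_card.
have n_gt0 : (0 < n)%N.
  by case: (n) lt_card => // ; rewrite expn0 ltnS leqNgt expn_gt0.
have Q_gt0 : (0 < Q)%N.
  by case: (Q) lt_card => // ; rewrite exp1n ltnS leqNgt expn_gt0.
pose A : R := n%:R * B * Q%:R.
have A_gt0 : 0 < A by rewrite !mulr_gt0 ?ltr0n.
have A2_gt0 : 0 < 2 * A by rewrite mulr_gt0.
pose L (a : {ffun 'I_n -> 'I_Q.+1}) j : R := \sum_i (a i)%:R * G i j.
have L_le a j : `|L a j| <= A.
  apply: le_trans (ler_norm_sum _ _ _) _.
  have -> : A = \sum_(i < n) (Q%:R * B).
    by rewrite sumr_const card_ord -[RHS]mulr_natl /A; ring.
  apply: ler_sum => i _; rewrite normrM ger0_norm ?ler0n //.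
  by rewrite ler_pM ?ler0n ?ler_nat // -ltnS.
(* Rescales the values from [-A, A] to [0, k]. Integer parts then give [k + 1] cells in each
   direction, since the endpoint [k] may be attained. *)
pose y a j := (L a j + A) * k%:R / (2 * A).
have y_ge0 a j : 0 <= y a j.
  apply: divr_ge0; last by rewrite mulr_ge0 ?ltW.
  by rewrite mulr_ge0 ?ler0n //; have := L_le a j; rewrite ler_norml; lra.
have y_le a j : y a j <= k%:R.
  rewrite /y ler_pdivrMr // [leRHS]mulrC ler_pM2r ?ltr0n //.
  by have := L_le a j; rewrite ler_norml; lra.
pose cell a : {ffun J -> 'I_k.+1} := [ffun j => inord (Num.truncn (y a j))].
have /injectivePn[a [b ab cell_ab]] : ~~ injectiveb cell.
  apply/negP => /injectiveP/leq_card; rewrite !card_ffun !card_ord.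
  by rewrite leqNgt lt_card.
have c_le (u v : 'I_Q.+1) : `|(u%:Z - v%:Z)%R| <= Q%:Z.
  by have := ltn_ord u; have := ltn_ord v; lia.
exists (fun i => (a i)%:Z - (b i)%:Z); split=> //.
  apply: contra_notP (elimN eqP ab) => nex; apply/ffunP => i; apply: val_inj.
  apply/eqP; rewrite -eqz_nat -subr_eq0; apply/negPn/negP => h.
  by apply: nex; exists i.
move=> j; have -> : \sum_i ((a i)%:Z - (b i)%:Z)%:~R * G i j = L a j - L b j.
  by rewrite -sumrB; apply: eq_bigr => i _; rewrite intrB mulrBl.
have : `|y a j - y b j| < 1.
  apply: truncn_eq_dist => //.
  have trunc_lt u : (Num.truncn (y u j) < k.+1)%N.
    by rewrite ltnS truncn_le_nat (le_lt_trans (y_le _ _)) // ltr_nat.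
  have /ffunP/(_ j) := cell_ab; rewrite !ffunE.
  by move=> /(congr1 val); rewrite /= !inordK.
have -> : y a j - y b j = (L a j - L b j) * (k%:R / (2 * A)).
  by rewrite /y -!mulrA -mulrBl; congr (_ * _); ring.
rewrite normrM [X in _ * X]ger0_norm; last first.
  by rewrite divr_ge0 ?ler0n // mulr_ge0 ?ltW.
rewrite mulrA ltr_pdivrMr // mul1r => /ltW le2A.
by rewrite ler_pdivlMr ?ltr0n // (le_trans le2A) // /A !mulrA.
Qed.

Lemma cofinal_fiber (T : finType) (F : nat -> T) :
  exists x, forall N, exists2 t, (N <= t)%N & F t = x.
Proof.
apply: contrapT => /forallNP none.
have /choice[N NP] : forall x, exists N, forall t, (N <= t)%N -> F t <> x.
  move=> x; have /existsNP[N nN] := none x; exists N => t Nt Ft.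
  by apply: nN; exists t.
by apply: (NP (F (\max_x N x)%N) (\max_x N x)%N _ erefl); exact: leq_bigmax.
Qed.

End Pigeonhole.

(** * Units that are small away from one Archimedean place *)

Section Units.
Variables (R : realType) (K : fieldExtType rat) (n : nat).
Variables (w : 'I_n -> K) (s : 'I_n -> {rmorphism K -> R[i]}).
Hypothesis n_gt0 : (0 < n)%N.
Hypothesis s_all : forall t : {rmorphism K -> R[i]}, exists j, t =1 s j.
Hypothesis s_w : \det (\matrix_(i, j) s j (w i)) != 0.
Hypothesis w_mul : forall i j, exists c : 'I_n -> int,
  w i * w j = \sum_k (c k)%:~R * w k.
Local Notation nc := (@ComplexField.Normc.normc R).
Local Notation ic := (int_comb w).

(** Distinguishes places rather than embeddings: a conjugate of [s j0] fails it. *)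
Definition distinct_abs (j0 j : 'I_n) : bool :=
  `[< exists x, nc (s j x) <> nc (s j0 x) >].

Lemma card_distinct_abs j0 : (#|distinct_abs j0| < n)%N.
Proof.
rewrite -[X in (_ < X)%N](card_ord n); apply: proper_card.
apply/fintype.properP; split; first exact/fintype.subsetP.
by exists j0 => //; apply/asboolPn => -[x].
Qed.

(* Replacing each embedding by the real form [Re + Im] treats real and complex
   places alike: at the conjugate embedding this form is [Re - Im], so two
   such forms control the absolute value. *)
Lemma small_elements j0 : let m := #|distinct_abs j0| in
  exists2 C : R, 0 < C & forall t, (0 < t)%N -> exists c : 'I_n -> int,
    [/\ exists i, c i != 0,
        forall j, distinct_abs j0 j ->
          nc (s j (ic c)) <= C * t%:R ^+ m / t%:R ^+ n &
        forall j, nc (s j (ic c)) <= C * t%:R ^+ m].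
Proof.
move=> m; pose B : R := 1 + \sum_(ij : 'I_n * 'I_n) nc (s ij.2 (w ij.1)).
have B_ge i j : nc (s j (w i)) <= B.
  rewrite /B (bigD1 (i, j)) //= addrCA lerDl addr_ge0 // sumr_ge0 // => *.
  exact: normc_ge0.
have B_gt0 : 0 < B.
  by rewrite ltr_pwDl // sumr_ge0 // => *; exact: normc_ge0.
have m_lt : (m < n)%N by exact: card_distinct_abs.
exists (16 * n%:R * B) => [|t t_gt0].
  by rewrite !mulr_gt0 // ltr0n.
have T_gt0 : 0 < t%:R :> R by rewrite ltr0n.
pose J := {j : 'I_n | distinct_abs j0 j}.
pose g (z : R[i]) := complex.Re z + complex.Im z.
have gE (c : 'I_n -> int) j : \sum_i (c i)%:~R * g (s j (w i)) = g (s j (ic c)).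
  rewrite rmorph_int_comb /g.
  have cE : forall i, (c i)%:~R * s j (w i) = ((c i)%:~R%:C)%C * s j (w i).
    by move=> i; rewrite rmorph_int.
  under [in RHS]eq_bigr do rewrite cE.
  rewrite (big_morph (@complex.Re R) (id1 := 0) (op1 := +%R)) //; last first.
    by case=> ? ? [].
  rewrite (big_morph (@complex.Im R) (id1 := 0) (op1 := +%R)) //; last first.
    by case=> ? ? [].
  rewrite -big_split; apply: eq_bigr => i _ /=.
  by case: (s j (w i)) => a b /=; ring.
(* With these parameters, [(t^n + 1)^m <= (2 t^n)^m <= (2 t^m)^n < (2 t^m + 1)^n]. The forms are
   then at most [8 n B t^m / t^n], and combining two of them gives the constant 16. *)
have [|||| c [c_neq0 c_le c_small]] := @small_linear_forms R n (2 * t ^ m) (t ^ n)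
    [the finType of J] (fun i j => g (s (val j) (w i))) (2 * B).
- by rewrite mulr_gt0.
- by rewrite expn_gt0 t_gt0.
- move=> i j; apply: le_trans (ler_normD _ _) _.
  have := B_ge i (val j); have := Re_le_normc (s (val j) (w i)).
  by have := Im_le_normc (s (val j) (w i)); lra.
- rewrite card_sig -/m; apply: (@leq_ltn_trans ((2 * t ^ n) ^ m)).
    have [->//|m_gt0] := posnP m; rewrite leq_exp2r //.
    by rewrite mul2n -addnn -addn1 leq_add2l expn_gt0 t_gt0.
  rewrite expnMn -expnM mulnC.
  apply: (@leq_ltn_trans ((2 * t ^ m) ^ n)); last by rewrite ltn_exp2r.
  rewrite expnMn -expnM mulnC [(n * m)%N]mulnC leq_mul2r leq_exp2l // ltnW //.
  by rewrite orbT.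
exists c; split=> // [j dj|j].
  have [j' j'E] := s_all (conjc \o s j).
  have dj' : distinct_abs j0 j'.
    move/asboolP: dj => [x nx]; apply/asboolP; exists x.
    by rewrite -j'E /= conjc_normc.
  have := c_small (Sub j dj); rewrite /= gE.
  have := c_small (Sub j' dj'); rewrite /= gE -j'E /=.
  have := normc_le_ReIm (s j (ic c)).
  rewrite natrM natrX natrX -[16]/(16%:R).
  have -> : 16%:R * n%:R * B * t%:R ^+ m / t%:R ^+ n =
    2 * (2 * n%:R * (2 * B) * (2%:R * t%:R ^+ m) / t%:R ^+ n) by ring.
  move: (_ / _) => e; case: (s j (ic c)) => a b /=; rewrite /g /=.
  move=> nab; rewrite !ler_norml => /andP[? ?] /andP[? ?]; apply: le_trans nab _.
  by case: (ltrgt0P a) => ?; case: (ltrgt0P b) => ?; lra.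
rewrite rmorph_int_comb; apply: le_trans (ler_normc_sum _ _ _) _.
have -> : 16%:R * n%:R * B * t%:R ^+ m = \sum_(i < n) (16%:R * B * t%:R ^+ m).
  by rewrite sumr_const card_ord -[RHS]mulr_natl; ring.
apply: ler_sum => i _; rewrite ComplexField.Normc.normcM normc_int.
have ci : `|c i|%:~R <= 2 * t%:R ^+ m :> R.
  by rewrite -natrX -natrM -[leRHS]/((Posz _)%:~R) ler_int; exact: c_le.
apply: le_trans (ler_pM _ _ ci (B_ge i j)) _; rewrite ?ler0z ?normc_ge0 //.
have : 0 <= B * t%:R ^+ m by rewrite mulr_ge0 ?exprn_ge0 ?ltW.
lra.
Qed.

(** The small elements have norms bounded independently of [t], so arbitrarily late ones share a
    norm and residues with a fixed one. The quotient by the fixed one is a unit, as small as desired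
    away from the place of [j0]. *)
Lemma dominated_unit j0 : exists u, [/\ is_unit u,
  forall j, distinct_abs j0 j -> nc (s j u) < 1 & \prod_j nc (s j u) = 1].
Proof.
have [C C_gt0 CP] := small_elements j0; set m := #|_| in CP.
have m_lt : (m < n)%N by exact: card_distinct_abs.
have /choice[c cP] := fun t => CP t.+1 isT.
have /choice[M ME] := fun t => int_comb_mul w_mul (c t).
have c_neq0 t : ic (c t) != 0.
  have [[i ci] _ _] := cP t; apply: contra ci => /eqP c0; apply/eqP.
  exact: (int_comb_eq0 s_w c0).
pose N t := \det (M t).
have NE t : `|N t|%:~R = \prod_j nc (s j (ic (c t))).
  by rewrite -normc_int -(prod_embeddings s_w (ME t)) normc_prod.
have N_neq0 t : N t != 0.
  rewrite -normr_eq0 -(intr_eq0 R) NE; apply/prodf_neq0 => j _.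
  by rewrite normc_eq0 fmorph_eq0 c_neq0.
pose L := (Num.truncn (C ^+ n)).+1.
have N_le t : (`|N t| <= L)%N.
  suff : `|N t|%:~R <= C ^+ n.
    rewrite -abszE -[_%:~R]/(_%:R) => NC; rewrite /L ltnW // ltnS.
    by rewrite truncn_ge_nat ?exprn_ge0 // ltW.
  rewrite NE (bigID (distinct_abs j0)) /=.
  set T : R := t.+1%:R; have T_gt0 : 0 < T by rewrite ltr0n.
  (* The powers of [T] cancel: [m] factors [T^m / T^n] against [n - m] factors [T^m]. *)
  apply: (@le_trans _ _ ((C * T ^+ m / T ^+ n) ^+ m * (C * T ^+ m) ^+ (n - m))).
    have [_ c1 c2] := cP t.
    apply: ler_pM; try by apply: prodr_ge0 => *; exact: normc_ge0.
      rewrite -prodr_const; apply: ler_prod => j dj; rewrite normc_ge0 /=.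
      exact: c1.
    have -> : (n - m)%N = #|[predC distinct_abs j0]|.
      by rewrite -[X in (X - _)%N](card_ord n) -(cardC (distinct_abs j0)) addKn.
    rewrite -prodr_const; apply: ler_prod => j dj; rewrite normc_ge0 /=.
    exact: c2.
  rewrite expr_div_n mulrAC -exprD subnKC 1?ltnW // exprMn -!exprM.
  by rewrite [(n * m)%N]mulnC mulfK // gt_eqF // exprn_gt0.
(* The key records the signed norm, shifted by [L] to be nonnegative, and the coordinates modulo
   [L!], a multiple of every possible norm. *)
pose key t : 'I_(2 * L).+1 * {ffun 'I_n -> 'I_(L`!).+1} :=
  (inord `|(N t + L%:Z)%R|%N, [ffun i => inord `|(c t i %% L`!)%Z|%N]).
have [x xP] := cofinal_fiber key.
have [t' _ kt'] := xP 0%N.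
(* The denominator [ic (c t')] is fixed first; for [t] past [T0] the bound [C / T] drops below its
   absolute value at every embedding. *)
pose T0 : R := \sum_j C / nc (s j (ic (c t'))).
have [t tT0 kt] := xP (Num.truncn T0).
have : key t = key t' by rewrite kt kt'.
move=> [/(congr1 val) keyN /ffunP keyc].
have NN : N t = N t'.
  have N_lt u : (`|(N u + L%:Z)%R| < (2 * L).+1)%N.
    by have := N_le u; move: (N u) (L) => a l; lia.
  move: keyN (N_le t) (N_le t'); rewrite /= !inordK //.
  move: (N t) (N t') (L) => a b l. lia.
have cc k : exists d, c t k = c t' k + N t * d.
  have := keyc k; rewrite !ffunE => /(congr1 val) /=.
  have mod_lt a : (`|(a %% L`!)%Z| < (L`!).+1)%N.
    have L_gt0 : (L`!)%:Z != 0 by rewrite eqz_nat -lt0n fact_gt0.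
    by have := ltz_mod a L_gt0; have := modz_ge0 a L_gt0; lia.
  rewrite !inordK // => modE.
  have /eqP : (c t k %% L`!)%Z = (c t' k %% L`!)%Z.
    have L_gt0 : (L`!)%:Z != 0 by rewrite eqz_nat -lt0n fact_gt0.
    rewrite -[LHS]gez0_abs ?modz_ge0 // -[RHS]gez0_abs ?modz_ge0 //.
    by rewrite modE.
  rewrite eqz_mod_dvd => LD.
  have /dvdzP[d dE] : (N t %| c t k - c t' k)%Z.
    apply: dvdz_trans LD; rewrite /dvdz /=; apply: dvdn_fact.
    by rewrite absz_gt0 N_neq0 N_le.
  by exists d; rewrite mulrC -dE addrC subrK.
have {cc}[d dE] := choice cc.
exists (ic (c t) / ic (c t')); split.
- split; first by rewrite mulf_neq0 ?invr_eq0 ?c_neq0.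
  + apply: (integral_div_congr n_gt0 s_w w_mul _ (ME t') (d := d)) => // k.
    by rewrite dE NN.
  + rewrite invf_div.
    apply: (integral_div_congr n_gt0 s_w w_mul _ (ME t)
              (d := fun k => - d k)) => // k.
    by rewrite dE mulrN addrK.
- move=> j dj; rewrite fmorph_div ComplexField.Normc.normcM.
  rewrite ComplexField.Normc.normcV.
  have nc_gt0 : 0 < nc (s j (ic (c t'))) by rewrite normc_gt0 fmorph_eq0 c_neq0.
  rewrite ltr_pdivrMr // mul1r; have [_ /(_ j dj) le _] := cP t.
  apply: le_lt_trans le _.
  set T : R := t.+1%:R; have T_gt0 : 0 < T by rewrite ltr0n.
  have T_ge1 : 1 <= T by rewrite ler1n.
  apply: (@le_lt_trans _ _ (C / T)).
    rewrite -[in leLHS](subnKC (ltnW m_lt)) exprD invfM mulrA mulfK; last first.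
      by rewrite gt_eqF // exprn_gt0.
    rewrite ler_pM2l // lef_pV2 ?posrE ?exprn_gt0 //.
    by apply: ler_eXnr; rewrite // subn_gt0.
  rewrite ltr_pdivrMr // mulrC -ltr_pdivrMr //.
  apply: le_lt_trans (_ : T0 < T).
    rewrite /T0 (bigD1 j) //= lerDl sumr_ge0 // => k _.
    by rewrite divr_ge0 ?normc_ge0 ?ltW.
  have T0_ge0 : 0 <= T0.
    by rewrite sumr_ge0 // => k _; rewrite divr_ge0 ?normc_ge0 ?ltW.
  by rewrite -truncn_lt_nat // ltnS.
transitivity (`|N t|%:~R / `|N t'|%:~R : R).
  rewrite !NE -prodf_div; apply: eq_bigr => j _.
  by rewrite fmorph_div ComplexField.Normc.normcM ComplexField.Normc.normcV.
by rewrite NN divff // intr_eq0 normr_eq0.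
Qed.

End Units.

(** * Independence of units through logarithms *)

Section UnitRank.
Variables (R : realType) (K : fieldExtType rat).
Local Notation nc := (@ComplexField.Normc.normc R).

Lemma ln_prod (I : Type) (t : seq I) (P : pred I) (F : I -> R) :
  (forall i, 0 < F i) ->
  ln (\prod_(i <- t | P i) F i) = \sum_(i <- t | P i) ln (F i).
Proof.
move=> F_gt0; have [] // : 0 < \prod_(i <- t | P i) F i /\
  ln (\prod_(i <- t | P i) F i) = \sum_(i <- t | P i) ln (F i).
apply: (big_ind2 (fun x y => 0 < x /\ ln x = y)); first by rewrite ln1.
  by move=> x1 y1 x2 y2 [x1_gt0 <-] [x2_gt0 <-]; rewrite mulr_gt0 // lnM.
by move=> i _; rewrite F_gt0.
Qed.

Lemma ln_normc_exprz (s : {rmorphism K -> R[i]}) (x : K) (m : int) : x != 0 ->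
  ln (nc (s (x ^ m))) = m%:~R * ln (nc (s x)).
Proof.
move=> x_neq0; have sx_gt0 : 0 < nc (s x) by rewrite normc_gt0 fmorph_eq0.
case: m => m /=; first by rewrite rmorphXn normcX lnXn // [RHS]mulr_natl.
rewrite NegzE -exprnN fmorphV rmorphXn ComplexField.Normc.normcV normcX.
by rewrite lnV ?posrE ?exprn_gt0 // lnXn // mulrNz mulNr [in RHS]mulr_natl.
Qed.

(* At a coordinate of maximal modulus of a kernel vector, the diagonal term
   strictly dominates the rest of the row. *)
Lemma dominant_matrix_det p (a : 'I_p.+1 -> 'I_p.+1 -> R) :
  (forall i k, k != i -> a i k < 0) -> (forall i, \sum_k a i k = 0) ->
  \det (\matrix_(i < p, k < p) a (lift ord_max i) (lift ord_max k)) != 0.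
Proof.
move=> a_lt0 a_sum; set M := \matrix_(i, k) _; rewrite -det_tr.
apply/det0P => -[v /rV0Pn[i0 vi0] vM].
have [i _ imax] := arg_maxP (fun i => `|v 0 i|) (erefl (xpredT i0)).
have vi_gt0 : 0 < `|v 0 i|.
  by apply: lt_le_trans (imax i0 isT); rewrite normr_gt0.
have := congr1 (fun u : 'rV_p => u 0 i) vM.
rewrite !mxE (bigD1 i) //= !mxE => /eqP; rewrite addr_eq0 => /eqP Mii.
set h := lift ord_max in Mii *.
have h_inj k l : k != l -> h k != h l.
  by apply: contra => /eqP/lift_inj ->.
(* The row sums to 0 and its entry in the dropped column [ord_max] is negative, so the diagonal
   entry strictly exceeds the total modulus of the other kept entries. *)
have row := a_sum (h i).
rewrite (bigD1_ord ord_max) //= (bigD1 i) //= -/h in row.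
have : `|v 0 i| * `|a (h i) (h i)| <=
    \sum_(k < p | k != i) `|v 0 i| * - a (h i) (h k).
  rewrite -normrM Mii normrN; apply: le_trans (ler_norm_sum _ _ _) _.
  apply: ler_sum => k ki; rewrite !mxE normrM.
  rewrite [X in _ * X <= _]ltr0_norm ?a_lt0 ?h_inj //.
  apply: ler_wpM2r; last exact: imax.
  by rewrite oppr_ge0 ltW // a_lt0 // h_inj.
rewrite -mulr_sumr ler_pM2l // sumrN leNgt => /negP; apply.
have := a_lt0 (h i) ord_max (neq_lift _ _).
by have := ler_norm (a (h i) (h i)); lra.
Qed.

Variables (n : nat) (w : 'I_n -> K) (s : 'I_n -> {rmorphism K -> R[i]}).
Hypothesis n_gt0 : (0 < n)%N.
Hypothesis s_all : forall t : {rmorphism K -> R[i]}, exists j, t =1 s j.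
Hypothesis s_w : \det (\matrix_(i, j) s j (w i)) != 0.
Hypothesis w_mul : forall i j, exists c : 'I_n -> int,
  w i * w j = \sum_k (c k)%:~R * w k.

(** Here [e] picks one embedding per Archimedean place. Logarithms turn a multiplicative relation
    into a kernel vector of a nonsingular matrix, one place and its unit being dropped. *)
Lemma independent_units p (e : 'I_p.+1 -> 'I_n) :
  (forall k l, k != l -> distinct_abs s (e k) (e l)) ->
  (forall j, exists k, forall x, nc (s j x) = nc (s (e k) x)) ->
  exists u : 'I_p -> K, (forall i, is_unit (u i)) /\ mult_independent u.
Proof.
move=> e_distinct /choice[f fE].
have fe k : f (e k) = k.
  apply/eqP/negPn/negP => /e_distinct/asboolP[x]; apply.
  exact/fE.
have /choice[u uP] := fun k => dominated_unit n_gt0 s_all s_w w_mul (e k).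
have u_neq0 k : u k != 0 by have [[]] := uP k.
have nc_gt0 k j : 0 < nc (s j (u k)) by rewrite normc_gt0 fmorph_eq0 u_neq0.
(* Weighting a place by the number of its embeddings makes each row sum the logarithm of the product
   over all embeddings, which equals 1. *)
pose a i k := #|[pred j | f j == k]|%:R * ln (nc (s (e k) (u i))).
have a_lt0 i k : k != i -> a i k < 0.
  move=> ki; have [_ u_lt1 _] := uP i; rewrite pmulr_rlt0.
    by apply: ln_lt0; rewrite nc_gt0 u_lt1 // e_distinct // eq_sym.
  by rewrite ltr0n; apply/card_gt0P; exists (e k); rewrite inE fe.
have a_sum i : \sum_k a i k = 0.
  have [_ _ u1] := uP i.
  transitivity (ln (\prod_j nc (s j (u i)))); last by rewrite u1 ln1.
  rewrite ln_prod // [RHS](partition_big f xpredT) //=; apply: eq_bigr => k _.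
  rewrite /a mulr_natl -sumr_const; apply: eq_big => // j /eqP <-.
  by rewrite -fE.
have det_neq0 := dominant_matrix_det a_lt0 a_sum.
exists (fun i => u (lift ord_max i)); split=> [i|c c1 i].
  by have [] := uP (lift ord_max i).
set M := \matrix_(_, _) _ in det_neq0.
have M_unit : M \in unitmx by rewrite unitmxE unitfE.
pose v : 'rV[R]_p := \row_i (c i)%:~R.
have vM : v *m M = 0.
  apply/rowP => k; rewrite !mxE; under eq_bigr do rewrite !mxE mulrCA.
  rewrite -mulr_sumr.
  under eq_bigr do rewrite -(ln_normc_exprz _ _ (u_neq0 _)).
  rewrite -ln_prod; last first.
    by move=> j; rewrite normc_gt0 fmorph_eq0 expfz_neq0 ?u_neq0.
  by rewrite -normc_prod -rmorph_prod c1 rmorph1 ComplexField.Normc.normc1 ln1 mulr0.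
have : v = 0 by rewrite -[v](mulmxK M_unit) vM mul0mx.
by move/rowP/(_ i); rewrite !mxE => /eqP; rewrite intr_eq0 => /eqP.
Qed.

End UnitRank.

(** * The height and the covering by boxes *)

Section ArchimedeanPlaces.
Variables (R : realType) (K : fieldExtType rat).

(** The [p + 1] places yield [p] independent units, so the maximality of [r] gives [p <= r], the
    lower bound in Dirichlet's unit theorem. *)
Lemma archimedean_places r : is_unit_rank K r -> exists p (v : 'I_p.+1 -> K -> R),
  [/\ (p <= r)%N, injective v & range v = range (@infinite_abs R K)].
Proof.
case=> _ rmax.
have [n [w [s [n_gt0 s_all s_w w_mul]]]] := field_lattice K R[i].
(* [undup] merges the embeddings with the same absolute value, such as conjugate ones. *)
pose vs := undup [seq infinite_abs (s j) | j <- enum 'I_n].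
have vsP (f : K -> R) : f \in vs -> exists j, f = infinite_abs (s j).
  by rewrite mem_undup => /mapP[j _ ->]; exists j.
have s_vs j : infinite_abs (s j) \in vs.
  by rewrite mem_undup map_f // mem_enum.
have vs_gt0 : (0 < size vs)%N.
  rewrite lt0n size_eq0; apply/eqP => vs0.
  by have := s_vs (Ordinal n_gt0); rewrite vs0.
exists (size vs).-1, (fun k => nth (fun=> 0) vs k).
have ltk (k : 'I_(size vs).-1.+1) : (k < size vs)%N.
  by rewrite -[ltnRHS](prednK vs_gt0).
have v_inj : injective (fun k : 'I_(size vs).-1.+1 => nth (fun=> 0) vs k).
  move=> k l /eqP; rewrite nth_uniq ?undup_uniq // => /eqP; exact: val_inj.
have vs_index (f : K -> R) : f \in vs ->
    exists k : 'I_(size vs).-1.+1, f = nth (fun=> 0) vs k.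
  move=> fvs; have f_lt : (index f vs < (size vs).-1.+1)%N.
    by rewrite prednK // index_mem.
  by exists (Ordinal f_lt); rewrite /= nth_index.
split=> //; last first.
  apply/seteqP; split=> [_ [k _ <-]|_ [t _ <-]].
    by have [j ->] := vsP _ (mem_nth (fun=> 0) (ltk k)); exists (s j).
  have [j tj] := s_all t.
  have -> : infinite_abs t = infinite_abs (s j).
    by apply/funext => x; rewrite /infinite_abs tj.
  by have [k ->] := vs_index _ (s_vs j); exists k.
have /choice[e eE] : forall k : 'I_(size vs).-1.+1, exists j,
    nth (fun=> 0) vs k = infinite_abs (s j).
  by move=> k; exact: vsP (mem_nth _ (ltk k)).
apply: rmax; apply: (@independent_units R K n w s n_gt0 s_all s_w w_mul _ e).
  move=> k l kl; apply/asboolP; apply: contrapT => /forallNP same.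
  case/eqP: kl; apply: v_inj; rewrite /= !eE; apply/funext => x.
  exact: esym (contrapT (same x)).
move=> j; have [k kE] := vs_index _ (s_vs j); exists k => x.
have := congr1 (fun f => f x) (etrans kE (eE k)).
by [].
Qed.

Variables (p : nat) (v : 'I_p.+1 -> K -> R).
Hypothesis v_inj : injective v.
Hypothesis v_range : range v = range (@infinite_abs R K).

Definition local_height k (a : K) : R := Num.max 1 (v k a ^+ local_degree (v k)).

Lemma height_integral a : ring_of_integers a ->
  height R a = \prod_k local_height k a.
Proof.
move=> Oa; pose vs := [seq v k | k <- enum 'I_p.+1].
have uniq_vs : uniq vs by rewrite map_inj_uniq ?enum_uniq.
have vsE : [set` vs] = range (@infinite_abs R K).
  rewrite -v_range; apply/seteqP; split=> [_ /mapP[k _ ->]|_ [k _ <-]].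
    by exists k.
  by rewrite /= map_f // mem_enum.
rewrite /height -(fsbig_widen [set` vs] (@places R K)).
- by rewrite -fsbig_seq // big_map big_enum.
- by rewrite vsE => f; left.
rewrite vsE => f [[//|[P nP <-]] _] /=.
rewrite max_l // exprn_ile1 ?finite_abs_le1 //.
by rewrite /finite_abs; case: ifP => // _; exact: powR_ge0.
Qed.

Lemma local_height_ge1 k a : 1 <= local_height k a.
Proof. by rewrite le_max lexx. Qed.

(** The Leibniz expansion has [w!] terms for [w] monomials, all dominated by a largest one [T g];
    bounding its factors row by row gives a product that does not depend on [g]. As [X] and [Y] are
    at least 1, the bound also absorbs the maximum with 1. *)
Lemma local_height_det (L M : nat) (W : {set 'I_L.+1 * 'I_M.+1}) k
    (P : 'I_#|W| -> K * K) (X Y : R) : 1 <= X -> 1 <= Y ->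
  (forall j, local_height k (P j).1 <= X) ->
  (forall j, local_height k (P j).2 <= Y) ->
  local_height k (\det (\matrix_(i < #|W|, j < #|W|)
                          monomial_eval (enum_val i) (P j)))
    <= (#|W|)`!%:R ^+ local_degree (v k) * \prod_(f in W) (X ^+ f.1 * Y ^+ f.2).
Proof.
move=> X_ge1 Y_ge1 hX hY.
have prod_ge1 : 1 <= \prod_(f in W) (X ^+ f.1 * Y ^+ f.2).
  apply: (big_ind (fun x => 1 <= x)) => // [x y x1 y1|f _];
    by rewrite mulr_ege1 ?exprn_ege1.
rewrite /local_height ge_max; apply/andP; split.
  by rewrite mulr_ege1 // exprn_ege1 // ler1n fact_gt0.
have [t _ tv] : range (@infinite_abs R K) (v k) by rewrite -v_range; exists k.
rewrite -tv; set d := local_degree _.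
set A := \matrix_(_, _) _.
pose T (g : 'S_(#|W|)) := \prod_i infinite_abs t (A i (g i)).
have abs_ge0 x : 0 <= infinite_abs t x by exact: normc_ge0.
have T_ge0 g : 0 <= T g by apply: prodr_ge0.
have [g _ gmax] := arg_maxP T (erefl (xpredT (1%g : 'S_(#|W|)))).
have det_le : infinite_abs t (\det A) <= (#|W|)`!%:R * T g.
  rewrite /infinite_abs rmorph_sum; apply: le_trans (ler_normc_sum _ _ _) _.
  rewrite -card_Sn mulr_natl -sumr_const; apply: ler_sum => h _.
  apply: le_trans (gmax h isT).
  rewrite rmorphM rmorph_sign ComplexField.Normc.normcM.
  have -> : ComplexField.Normc.normc ((-1) ^+ h : R[i]) = 1.
    have -> : (-1 : R[i]) = (-1)%:~R by [].
    by rewrite normcX normc_int normrN normr1 expr1n.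
  by rewrite mul1r rmorph_prod normc_prod.
apply: le_trans (lerXn2r d (abs_ge0 _) _ det_le) _.
  by rewrite nnegrE mulr_ge0 ?T_ge0.
rewrite exprMn ler_wpM2l ?exprn_ge0 ?ler0n //.
rewrite big_enum_val -prodrXl; apply: ler_prod => i _.
rewrite exprn_ge0 ?abs_ge0 //= mxE /infinite_abs rmorphM !rmorphXn.
rewrite ComplexField.Normc.normcM !normcX exprMn -!exprM ![(_ * d)%N]mulnC !exprM.
have hmax x : ComplexField.Normc.normc (t x) ^+ d <= local_height k x.
  by rewrite /local_height -tv le_max lexx orbT.
by apply: ler_pM; rewrite ?exprn_ge0 ?normc_ge0 //; apply: lerXn2r;
   rewrite ?nnegrE ?exprn_ge0 ?normc_ge0 ?(le_trans ler01) //;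
   apply: le_trans (hmax _) _.
Qed.

End ArchimedeanPlaces.

(** For finite [S] a largest fiber works. For infinite [S] some fiber is infinite, and the right
    side is then infinite. *)
Lemma counting_fiber (R : realType) (T : choiceType) (I : finType) (i0 : I)
    (f : T -> I) (S : set T) : exists i,
  (counting S <= #|I|%:R%:E * counting (S `&` f @^-1` [set i]) :> \bar R)%E.
Proof.
have I_gt0 : (0 < #|I|)%N by apply/card_gt0P; exists i0.
have [Sfin|Sinf] := pselect (finite_set S); last first.
  have [i infi] : exists i, infinite_set (S `&` f @^-1` [set i]).
    apply: contrapT => /forallNP fin; apply: Sinf.
    have -> : S = \bigcup_(i in [set: I]) (S `&` f @^-1` [set i]).
      apply/seteqP; split=> [x Sx|x [i _ []//]].
      by exists (f x).
    by apply: bigcup_finite => [|i _]; [exact: finite_finset|exact: contrapT].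
  exists i; rewrite /counting [in leRHS]asboolF //.
  by rewrite gt0_muley ?leey // lte_fin ltr0n.
have fin i : finite_set (S `&` f @^-1` [set i]) by exact: finite_setIl.
pose c i := #|` fset_set (S `&` f @^-1` [set i])|.
have [i _ imax] := @arg_maxnP I i0 xpredT c isT.
exists i; rewrite /counting !asboolT // -EFinM lee_fin -natrM ler_nat.
apply: (@leq_trans (\sum_i c i)%N); last first.
  rewrite -sum_nat_const; apply: leq_sum => j _; exact: imax.
rewrite card_fset_sum1 (partition_big f xpredT) //=.
apply: leq_sum => j _; rewrite /c card_fset_sum1.
rewrite -big_filter.
rewrite [leqRHS](perm_big [seq x <- fset_set S | f x == j]) //.
apply: uniq_perm; rewrite ?filter_uniq ?fset_uniq //.
move=> x; rewrite mem_filter !in_fset_set // in_setI andbC; congr (_ && _).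
by apply/idP/eqP; rewrite inE.
Qed.

(** * Logarithmic boxes *)

Section BoxCovering.
Variables (R : realType) (T : Type) (p : nat) (h : 'I_p.+1 -> T -> R).
Hypothesis h_ge1 : forall k a, 1 <= h k a.

(** The coordinate [ord0] is not recorded: the bound on the product controls it. This saves one
    factor [ln H] in the count. *)
Definition box_index (H : R) (a : T) :
    {ffun 'I_p -> 'I_(Num.truncn (ln H)).+1} :=
  [ffun k => inord (Num.truncn (ln (h (lift ord0 k) a)))].

(** A recorded coordinate gets the upper end of its interval, and [ord0] gets [H] over the product
    of the lower ends, so the product of all bounds exceeds [H] only by the factor [e^p]. *)
Definition box_bound (H : R) (x : {ffun 'I_p -> 'I_(Num.truncn (ln H)).+1})
    (k : 'I_p.+1) : R :=
  if unlift ord0 k is Some l then expR ((x l)%:R + 1)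
  else H / \prod_l expR (x l)%:R.

Lemma prod_box_bound H x : \prod_k box_bound (H := H) x k = expR 1 ^+ p * H.
Proof.
rewrite (bigD1_ord ord0) //= {1}/box_bound unlift_none.
have -> : \prod_(l < p) box_bound x (lift ord0 l)
    = expR 1 ^+ p * \prod_l expR (x l)%:R.
  rewrite -[X in _ ^+ X]card_ord -prodr_const -big_split.
  by apply: eq_bigr => l _; rewrite /box_bound liftK expRD mulrC.
rewrite mulrC -mulrA [X in _ * X]mulrC divfK //.
by apply/prodf_neq0 => l _; rewrite gt_eqF // expR_gt0.
Qed.

Lemma le_box_bound H a k : \prod_k h k a <= H ->
  h k a <= box_bound (box_index H a) k.
Proof.
move=> hH; have h_gt0 l : 0 < h l a by exact: lt_le_trans ltr01 (h_ge1 _ _).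
have prod_gt0 (P : pred 'I_p.+1) : 0 < \prod_(l | P l) h l a.
  by apply: prodr_gt0.
have prod_ge1 (P : pred 'I_p.+1) : 1 <= \prod_(l | P l) h l a.
  by apply: (big_ind (fun x => 1 <= x)) => // *; exact: mulr_ege1.
(* The other factors are at least 1. This makes the truncated logarithms fit the index type, so that
   [inord] does not alter them. *)
have h_le l : h l a <= H.
  apply: le_trans hH; rewrite (bigD1 l) //= ler_peMr // ltW //.
have trunc_lt l : (Num.truncn (ln (h l a)) < (Num.truncn (ln H)).+1)%N.
  rewrite ltnS le_truncn // ler_ln ?posrE //.
  exact: lt_le_trans (h_le l).
have ln_itv l := truncn_itv (ln_ge0 (h_ge1 l a)).
rewrite /box_bound; case: unliftP => [l|] ->.
  rewrite ffunE inordK // natr1 -[leLHS]lnK ?posrE // ler_expR.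
  by have /andP[_ /ltW] := ln_itv (lift ord0 l).
rewrite ler_pdivlMr; last by apply: prodr_gt0 => l _; exact: expR_gt0.
apply: le_trans hH; rewrite [leRHS](bigD1_ord ord0) //=.
rewrite ler_pM2l //; apply: ler_prod => l _; rewrite expR_ge0 /=.
rewrite ffunE inordK // -[leRHS]lnK ?posrE // ler_expR.
by have /andP[] := ln_itv (lift ord0 l).
Qed.

End BoxCovering.

(** Since [ln H >= ln 2], the summand 1 is at most [ln H / ln 2]. The resulting base is at least 1,
    so the exponent may grow from [2 * p] to [2 * r]. *)
Lemma box_count_le (R : realType) (p r : nat) (H : R) : (p <= r)%N -> 2 <= H ->
  ((Num.truncn (ln H)).+1 ^ (2 * p))%:R
    <= ((1 + (ln 2)^-1) * ln H) ^+ (2 * r).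
Proof.
move=> pr H2; have ln2_gt0 : 0 < ln 2 :> R by rewrite ln_gt0 // ltr1n.
have ln_le : ln 2 <= ln H by rewrite ler_ln ?posrE // (lt_le_trans _ H2).
have le_c : ln H + 1 <= (1 + (ln 2)^-1) * ln H.
  by rewrite mulrDl mul1r lerD2l mulrC ler_pdivlMr // mul1r.
have lnH_ge0 : 0 <= ln H by exact: le_trans (ltW ln2_gt0) ln_le.
have trunc_le : (Num.truncn (ln H))%:R <= ln H by rewrite truncn_le.
rewrite natrX; apply: (@le_trans _ _ (((1 + (ln 2)^-1) * ln H) ^+ (2 * p))).
  apply: lerXn2r; rewrite ?nnegrE ?ler0n //; first lra.
  by rewrite -natr1; lra.
by apply: ler_weXn2l; [lra|rewrite leq_mul2l].
Qed.

(** * The popular pair of boxes and the determinant bound *)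

Theorem proposition5p1 (R : realType) (K : fieldExtType rat) (r : nat)
    (hr : is_unit_rank K r) :
  exists b : R, 0 < b /\
  forall (L M : nat) (W : {set 'I_L.+1 * 'I_M.+1}), W != finset.set0 ->
  exists B : R, 0 < B /\
  forall (H : R), 2 <= H ->
  forall S : set (K * K), S `<=` integral_points K H ->
  exists S' : set (K * K),
    [/\ S' `<=` S,
        ((b / ln H ^+ (2 * r))%:E * counting S <= counting S')%E &
        forall P : 'I_#|W| -> K * K, (forall j, S' (P j)) ->
          height R (\det (\matrix_(i < #|W|, j < #|W|)
                            monomial_eval (enum_val i) (P j)))
            <= B * H ^+ (\sum_(f in W) monomial_deg f)].
Proof.
have [p [v [pr v_inj v_range]]] := archimedean_places R hr.
have ln2_gt0 : 0 < ln 2 :> R by rewrite ln_gt0 // ltr1n.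
have c_gt0 : 0 < 1 + (ln 2)^-1 :> R by rewrite addr_gt0 // invr_gt0.
(* The inverse of the constant in [box_count_le]; it depends on [K] only through [r]. *)
exists (((1 + (ln 2)^-1) ^+ (2 * r))^-1); split.
  by rewrite invr_gt0 exprn_gt0.
move=> L M W W_neq0.
pose E : R := expR 1 ^+ p.
have E_gt0 : 0 < E by rewrite exprn_gt0 // expR_gt0.
pose F : R := \prod_k (#|W|)`!%:R ^+ local_degree (v k).
(* [F] collects the factorials of the Leibniz expansions over the places, and [E] is the loss in the
   product of the box bounds. *)
exists (F * E ^+ (\sum_(f in W) monomial_deg f)); split.
  rewrite mulr_gt0 ?exprn_gt0 //; apply: prodr_gt0 => k _.
  by rewrite exprn_gt0 // ltr0n fact_gt0.
move=> H H2 S SH.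
have H_gt0 : 0 < H by exact: lt_le_trans H2.
have h_ge1 := local_height_ge1 v.
pose key (P : K * K) :=
  (box_index (local_height v) H P.1, box_index (local_height v) H P.2).
have [x] := counting_fiber R (key 0) key S.
set S' := S `&` _ => countS; exists S'; split; first by move=> P [].
  have lnH_gt0 : 0 < ln H by rewrite ln_gt0 // (lt_le_trans _ H2) // ltr1n.
  have b_ge0 : 0 <= ((1 + (ln 2)^-1) ^+ (2 * r))^-1 / ln H ^+ (2 * r).
    by rewrite divr_ge0 ?invr_ge0 ?exprn_ge0 ?ltW.
  apply: le_trans (lee_wpmul2l _ countS) _; first by rewrite lee_fin.
  rewrite muleA -EFinM -[leRHS]mul1e; apply: lee_wpmul2r.
    by rewrite /counting; case: ifP => _; rewrite ?lee_fin ?leey.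
  rewrite lee_fin -invfM -exprMn mulrC ler_pdivrMr ?mul1r; last first.
    by rewrite exprn_gt0 // mulr_gt0.
  apply: le_trans (box_count_le pr H2).
  by rewrite card_prod !card_ffun !card_ord mulSn mul1n expnD.
move=> P S'P.
have [PO1 PO2 PH1 PH2] : [/\ forall j, ring_of_integers (P j).1,
    forall j, ring_of_integers (P j).2,
    forall j, \prod_k local_height v k (P j).1 <= H &
    forall j, \prod_k local_height v k (P j).2 <= H].
  split=> j; have [/SH SP _] := S'P j; have [int1 int2 ? ?] := SP => //.
    by rewrite -height_integral.
  by rewrite -height_integral.
have PX j k : local_height v k (P j).1 <= box_bound x.1 k.
  by have [_ /= <-] := S'P j; exact: le_box_bound.
have PY j k : local_height v k (P j).2 <= box_bound x.2 k.
  by have [_ /= <-] := S'P j; exact: le_box_bound.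
have W_gt0 : (0 < #|W|)%N by rewrite card_gt0.
(* A point of [S'] shows that the box bounds are at least 1, since they dominate its local
   heights. *)
pose j0 := Ordinal W_gt0.
have X_ge1 k : 1 <= box_bound x.1 k by exact: le_trans (h_ge1 _ _) (PX j0 k).
have Y_ge1 k : 1 <= box_bound x.2 k by exact: le_trans (h_ge1 _ _) (PY j0 k).
rewrite (height_integral v_inj v_range); last first.
  apply: ring_of_integers_det => i j; rewrite mxE.
  by apply: ring_of_integersM; exact: ring_of_integersX.
apply: (@le_trans _ _ (\prod_k ((#|W|)`!%:R ^+ local_degree (v k) *
    \prod_(f in W) (box_bound x.1 k ^+ f.1 * box_bound x.2 k ^+ f.2)))).
  apply: ler_prod => k _; rewrite (le_trans ler01) //=.
  by apply: local_height_det.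
(* Exchanging the products collects, for each monomial, the box bounds over all places, whose
   product is [E * H] for each of the two variables. *)
rewrite big_split -/F exchange_big /= -mulrA -exprMn.
rewrite -prodrXr le_eqVlt; apply/orP; left; apply/eqP; congr (_ * _).
apply: eq_bigr => f _.
by rewrite big_split /= !prodrXl !prod_box_bound -exprD.
Qed.
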